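(* Let $m$ and $n$ be positive integers, let $\omega$ be a unit modulo $mn$, and let $\sigma_\omega$ be the associated cyclic supercharacter mod $mn$. Write $\omega_m$ and $\omega_n$ for the residues of $\omega$ modulo $m$ and modulo $n$. If $\operatorname{ord}(\omega_n)=uv$ for positive integers $u,v$ with $\gcd(v,\operatorname{ord}(\omega_m))=1$, then $$\sigma_\omega(sm+tn)=\sum_{j=1}^{u}\sigma_{\omega_m^u}(\omega^j t)\,\sigma_{\omega_n^u}(\omega^j s)$$ for all integers of the form $sm+tn$ (with $s,t$ integers). Here $\sigma_{\omega_m^u}$ is the cyclic supercharacter mod $m$ associated to $\omega_m^u$, and $\sigma_{\omega_n^u}$ is the cyclic supercharacter mod $n$ associated to $\omega_n^u$.
   Context: Write $e(\theta)=\exp(2\pi i\theta)$ for real $\theta$. For a positive integer $N$ and a unit $\omega$ mod $N$ of multiplicative order $d=\operatorname{ord}(\omega)$, the cyclic supercharacter mod $N$ associated to $\omega$ is the function $\sigma_\omega:\mathbb{Z}/N\mathbb{Z}\to\mathbb{C}$, $\sigma_\omega(y)=\sum_{j=1}^{d} e\left(\frac{\omega^j y}{N}\right)$. It is also regarded as a function on $\mathbb{Z}$ of period $N$. Integers are treated as residues where appropriate; in $\sigma_{\omega_m^u}(\omega^j t)$ the argument is reduced mod $m$, and in $\sigma_{\omega_n^u}(\omega^j s)$ it is reduced mod $n$.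
   Formalization: Added hypothesis: m and n are coprime, or ord(ω) = lcm(ord(ω_m), ord(ω_n)). Without it the claim is false: for m = n = 2, ω = 3, u = v = 1, s = t = 0 the left side is 2 and the right side is 1; at s = t = 0 the claim forces this condition. *)

(* Defs.v *)
From HB Require Import structures.
From mathcomp Require Import all_boot all_order all_algebra cyclic.
From mathcomp Require Import all_classical all_reals all_analysis.
From mathcomp Require Export complex.

Set Implicit Arguments.
Unset Strict Implicit.
Unset Printing Implicit Defensive.

Import Order.TTheory GRing.Theory Num.Theory.

Local Open Scope ring_scope.

(* Residues modulo N are represented by arbitrary integers, and "a is a unit
   modulo N" by [coprimez a N].  The types ['Z_N] are avoided because ['Z_1]
   is Z/2Z, whereas N = 1 must be allowed below. *)

(* The multiplicative order of a modulo N: the least d > 0 such that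
   a ^ d = 1 modulo N.  The search is bounded by N, which suffices when N > 0
   and a is a unit modulo N (see [ordmod_spec]); otherwise the value may be
   the meaningless N.+1. *)
Definition ordmod (N : nat) (a : int) : nat :=
  (find (fun k => (a ^+ k.+1 == 1 %[mod N])%Z) (iota 0 N)).+1.

Lemma ordmod_spec (N : nat) (a : int) : (0 < N)%N -> coprimez a N ->
  (a ^+ ordmod N a = 1 %[mod N])%Z /\
  (forall d, (0 < d)%N -> (a ^+ d = 1 %[mod N])%Z -> (ordmod N a <= d)%N).
Proof.
move=> N0 aN.
set p := fun k => (a ^+ k.+1 == 1 %[mod N])%Z.
have hasp : has p (iota 0 N).
  apply/hasP; exists (totient N).-1.
    rewrite mem_iota /= add0n prednK ?totient_gt0 // totient_count_coprime.
    rewrite big_mkord; apply: (leq_trans (n := \sum_(i < N) 1)%N).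
      by apply: leq_sum => i _; exact: leq_b1.
    by rewrite sum1_card card_ord.
  rewrite /p prednK ?totient_gt0 //.
  have [b ab] : exists b : nat, (a %% N)%Z = b%:Z.
    have : (0 <= a %% N)%Z by apply: modz_ge0; rewrite -lt0n.
    by case: ((a %% N)%Z) => // b _; exists b.
  have bN : coprime b N.
    have : coprimez (a %% N)%Z N by rewrite /coprimez gcdz_modl.
    by rewrite ab.
  rewrite -modzXm ab -rmorphXn /=.
  by rewrite !modz_nat Euler_exp_totient.
split.
  have := nth_find 0%N hasp.
  by rewrite nth_iota ?add0n -?[X in (_ < X)%N](size_iota 0 N) -?has_find // => /eqP.
move=> [//|d] _ ad; rewrite /ordmod ltnS leqNgt; apply/negP => ltd.
have := before_find 0%N ltd; rewrite nth_iota ?add0n /p ?ad ?eqxx //.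
by apply: (leq_trans ltd); rewrite -[X in (_ <= X)%N](size_iota 0 N) find_size.
Qed.

(* exp (2 pi i theta) *)
Definition e (R : realType) (theta : R) : R[i] :=
  Complex (cos (2 * pi * theta)) (sin (2 * pi * theta)).

(* The cyclic supercharacter mod N associated to the residue of a, as an
   N-periodic function of the integer y. *)
Definition supercharacter (R : realType) (N : nat) (a y : int) : R[i] :=
  \sum_(1 <= j < (ordmod N a).+1) e ((a ^+ j * y)%:~R / N%:R).

(* Main.v *)
Require Import Defs.
From mathcomp Require Import all_boot all_order all_algebra.
From mathcomp Require Import all_classical all_reals all_analysis.
From mathcomp Require Import ring.

(** Write A = ord (omega_m), so that ord (omega_n) = u v with v prime to A, and
    put a = A / gcd (A, u), the order of omega_m ^ u.  Since

      (s m + t n) / (m n) = s / n + t / m,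

    the left-hand side is the sum over one period of omega of the products
    e (omega ^ k t / m) e (omega ^ k s / n), in which the first factor has
    period A in k and the second has period u v.  The period of omega is
    lcm (A, u v), by [ordmod_mul_coprime] when m and n are coprime and by
    hypothesis otherwise, and lcm (A, u v) = a v u ([lcm_mul_coprime]).

    Splitting k = j + u q according to its class j modulo u ([sum_residues]),
    the two factors become functions of q, for q < a v, of the coprime periods
    a and v, which are the orders of omega_m ^ u and omega_n ^ u ([ordmodX]).
    By the Chinese remainder theorem the pair of residues (q mod a, q mod v)
    runs once through all pairs, so the sum over q of the products is the
    product of the two sums over a full period ([sum_crt]).  These are the two
    supercharacters in the j-th term of the right-hand side. *)

Import Order.TTheory GRing.Theory Num.Theory.

Local Open Scope ring_scope.

Lemma eD (R : realType) (x y : R) : e (x + y) = e x * e y.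
Proof.
by rewrite /e mulrDr cosD sinD [sin _ * _ + _]addrC; simpc.
Qed.

Lemma e_nat (R : realType) (k : nat) : e k%:R = 1 :> R[i].
Proof.
rewrite /e; have -> : 2 * pi * k%:R = 0 + (pi *+ 2) *+ k :> R.
  by rewrite add0r mulr_natl mulr_natr.
by rewrite (periodicn (@cosD2pi R)) (periodicn (@sinD2pi R)) cos0 sin0.
Qed.

Lemma e_int (R : realType) (z : int) : e z%:~R = 1 :> R[i].
Proof.
case: (intP z) => [|k|k]; [exact: (e_nat _ 0)|exact: e_nat|].
by rewrite -[LHS]mulr1 -[X in _ * X](e_nat R k.+1) -eD mulrNz addNr (e_nat R 0).
Qed.

Lemma eq_e_mod (R : realType) (N : nat) (x y : int) : (0 < N)%N ->
  (x = y %[mod N])%Z -> e (x%:~R / N%:R) = e (y%:~R / N%:R) :> R[i].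
Proof.
move=> N0; have N0R : N%:R != 0 :> R by rewrite pnatr_eq0 -lt0n.
have e_mod z : e (z%:~R / N%:R) = e ((z %% N)%Z%:~R / N%:R) :> R[i].
  rewrite {1}(divz_eq z N) intrD intrM mulrDl mulfK // eD e_int.
  by rewrite mul1r.
by move=> xy; rewrite e_mod xy -e_mod.
Qed.

(** Orders are only ever compared through their multiples: two orders with the
    same multiples are equal, and the multiples of [ordmod N a] are the exponents
    that kill [a]. *)
Lemma expz_ordmod_dvd (N : nat) (a : int) (k : nat) :
  (0 < N)%N -> coprimez a N ->
  (a ^+ k == 1 %[mod N])%Z = (ordmod N a %| k)%N.
Proof.
move=> N0 aN; have [a1 amin] := ordmod_spec N0 aN.
have red : (a ^+ k = a ^+ (k %% ordmod N a) %[mod N])%Z.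
  rewrite [in LHS](divn_eq k (ordmod N a)) exprD mulnC exprM -modzMml -modzXm.
  by rewrite a1 modzXm expr1n modzMml mul1r.
rewrite red /dvdn; case: (posnP (k %% ordmod N a)) => [->|r0].
  by rewrite expr0 eqxx.
apply/negbTE/negP => /eqP /(amin _ r0).
by rewrite leqNgt ltn_mod.
Qed.

Lemma expz_mod_ordmod (N : nat) (a : int) (i j : nat) :
  (0 < N)%N -> coprimez a N -> i = j %[mod ordmod N a] ->
  (a ^+ i = a ^+ j %[mod N])%Z.
Proof.
move=> N0 aN; wlog ij : i j / (i <= j)%N => [H|].
  by case: (leqP i j) => [|/ltnW] ? ?; [|symmetry]; apply: H.
move/eqP; rewrite eq_sym eqn_mod_dvd // -expz_ordmod_dvd // => /eqP H.
by rewrite -(subnK ij) exprD -modzMml H modzMml mul1r.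
Qed.

Lemma ordmod_modz (N : nat) (a : int) : ordmod N (a %% N)%Z = ordmod N a.
Proof. by congr _.+1; apply: eq_find => k; rewrite modzXm. Qed.

Lemma ordmodX (N : nat) (a : int) (u : nat) :
  (0 < N)%N -> coprimez a N -> (0 < u)%N ->
  ordmod N (a ^+ u) = (ordmod N a %/ gcdn (ordmod N a) u)%N.
Proof.
move=> N0 aN u0; have g0 : (0 < gcdn (ordmod N a) u)%N.
  by rewrite gcdn_gt0 u0 orbT.
have H k : (ordmod N (a ^+ u) %| k)%N =
           (ordmod N a %/ gcdn (ordmod N a) u %| k)%N.
  rewrite -expz_ordmod_dvd ?coprimezXl // -exprM expz_ordmod_dvd //.
  rewrite dvdn_divLR ?dvdn_gcdl // muln_gcdr dvdn_gcd (dvdn_mull k (dvdnn _)).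
  by rewrite mulnC.
by apply/eqP; rewrite eqn_dvd H dvdnn -H dvdnn.
Qed.

(** A power of [a] is 1 modulo [m * n] iff it is 1 modulo both factors, so the
    exponents that kill [a] modulo [m * n] are the common multiples of its two
    orders. *)
Lemma ordmod_mul_coprime (m n : nat) (a : int) :
  (0 < m)%N -> (0 < n)%N -> coprimez a m -> coprimez a n -> coprime m n ->
  ordmod (m * n) a = lcmn (ordmod m a) (ordmod n a).
Proof.
move=> m0 n0 am an mn.
have H k : (ordmod (m * n) a %| k)%N =
           (lcmn (ordmod m a) (ordmod n a) %| k)%N.
  rewrite -expz_ordmod_dvd ?muln_gt0 ?m0 ?PoszM ?coprimezMr ?am //.
  by rewrite zchinese_remainder // !expz_ordmod_dvd // dvdn_lcm.
by apply/eqP; rewrite eqn_dvd H dvdnn -H dvdnn.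
Qed.

(** The factor [v], being prime to [A], contributes in full to the least common
    multiple; the remaining [A] and [u] contribute [lcmn A u], written here so
    that [A %/ gcdn A u], the order of a [u]-th power, is visible. *)
Lemma lcm_mul_coprime (A u v : nat) : (0 < u)%N -> coprime v A ->
  lcmn A (u * v) = (A %/ gcdn A u * v * u)%N.
Proof.
move=> u0 vA; have g0 : (0 < gcdn A u)%N by rewrite gcdn_gt0 u0 orbT.
apply/eqP; rewrite -(eqn_pmul2r (m := gcdn A u)) //.
rewrite -{1}[gcdn A u](@Gauss_gcdl A u v) 1?coprime_sym // muln_lcm_gcd.
rewrite -{1}(divnK (dvdn_gcdl A u)) [eqbRHS]mulnAC [X in _ == (X * _)%N]mulnAC.
by rewrite -!mulnA [(v * u)%N]mulnC.
Qed.

(** Supercharacters sum over the exponents 1, ..., d, whereas residues modulo d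
    are 0, ..., d - 1; over a full period the two ranges agree. *)
Lemma sum_period_shift (V : nmodType) (F : nat -> V) (d : nat) : F d = F 0%N ->
  \sum_(1 <= j < d.+1) F j = \sum_(0 <= j < d) F j.
Proof.
case: d => [|d] Fd; first by rewrite !big_geq.
by rewrite big_nat_recr //= Fd big_add1 /= big_nat_recl // addrC.
Qed.

(** Reduction of [q] to its pair of residues is a bijection onto
    ['I_a * 'I_b] by the Chinese remainder theorem, so the left-hand side runs
    over all products of a value of [F] and a value of [G]. *)
Lemma sum_crt (K : comPzSemiRingType) (F G : nat -> K) (a b : nat) :
  (0 < a)%N -> (0 < b)%N -> coprime a b ->
  (forall i, F (i %% a)%N = F i) -> (forall i, G (i %% b)%N = G i) ->
  \sum_(0 <= q < a * b) F q * G q =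
  (\sum_(0 <= i < a) F i) * (\sum_(0 <= j < b) G j).
Proof.
move=> a0 b0 ab Fa Gb; rewrite !big_mkord mulr_suml.
under [RHS]eq_bigr do rewrite mulr_sumr.
rewrite pair_bigA /=.
pose h (q : 'I_(a * b)) : 'I_a * 'I_b :=
  (Ordinal (ltn_pmod q a0), Ordinal (ltn_pmod q b0)).
have h_inj : injective h.
  move=> x y [] /eqP xa /eqP xb; apply/val_inj/eqP.
  have := chinese_remainder ab x y; rewrite xa xb /=.
  by rewrite !modn_small.
have h_bij : bijective h.
  by apply: inj_card_bij h_inj _; rewrite card_prod !card_ord.
rewrite (reindex h) /=; last exact: onW_bij.
by apply: eq_bigr => q _; rewrite Fa Gb.
Qed.

Lemma sum_residues (V : nmodType) (F : nat -> V) (u w : nat) :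
  \sum_(1 <= k < (w * u).+1) F k =
  \sum_(1 <= j < u.+1) \sum_(0 <= q < w) F (j + u * q)%N.
Proof.
rewrite !big_add1 /= big_nat_mul exchange_big /=.
apply: eq_bigr => q _; rewrite -[X in \sum_(X <= _ < _) _]add0n big_addn.
rewrite mulSn addnK; apply: eq_bigr => j _.
by rewrite addSn mulnC.
Qed.

Theorem theorem3p2 (R : realType) (m n : nat) (omega : int) (u v : nat)
  (m_gt0 : (0 < m)%N) (n_gt0 : (0 < n)%N)
  (omega_unit : coprimez omega (m * n)%N)
  (u_gt0 : (0 < u)%N) (v_gt0 : (0 < v)%N) :
  let omega_m := (omega %% m)%Z in
  let omega_n := (omega %% n)%Z in
  forall (mn_ord : coprime m n \/
     ordmod (m * n) omega = lcmn (ordmod m omega_m) (ordmod n omega_n)),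
  ordmod n omega_n = (u * v)%N ->
  coprime v (ordmod m omega_m) ->
  forall s t : int,
    supercharacter R (m * n) omega (s * m%:Z + t * n%:Z) =
    \sum_(1 <= j < u.+1)
      supercharacter R m (omega_m ^+ u) (omega ^+ j * t) *
      supercharacter R n (omega_n ^+ u) (omega ^+ j * s).
Proof.
move=> omega_m omega_n.
have := omega_unit; rewrite PoszM coprimezMr => /andP[om on].
have omm : coprimez omega_m m by rewrite /coprimez gcdz_modl.
have onn : coprimez omega_n n by rewrite /coprimez gcdz_modl.
rewrite !ordmod_modz => mn_ord ord_n vA s t.
have ordL : ordmod (m * n) omega =
    (ordmod m omega %/ gcdn (ordmod m omega) u * v * u)%N.
  rewrite -lcm_mul_coprime // -ord_n.
  by case: mn_ord => // mn; exact: ordmod_mul_coprime.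
set a := (_ %/ _)%N in ordL.
have ord_mu : ordmod m (omega_m ^+ u) = a by rewrite ordmodX // ordmod_modz.
have ord_nu : ordmod n (omega_n ^+ u) = v.
  by rewrite ordmodX // ordmod_modz ord_n gcdnC gcdnMr mulKn.
have av : coprime a v.
  apply: (coprime_dvdl _ (n := ordmod m omega)); last by rewrite coprime_sym.
  by rewrite dvdn_divLR ?dvdn_gcdl ?dvdn_mulr // gcdn_gt0 u_gt0 orbT.
pose psi N (b z : int) i := e ((b ^+ i * z)%:~R / N%:R) : R[i].
have psi_mod N (b z : int) i : (0 < N)%N -> coprimez b N ->
    psi N b z (i %% ordmod N b)%N = psi N b z i.
  move=> N0 bN; apply: eq_e_mod => //.
  by rewrite -modzMml (@expz_mod_ordmod _ _ _ i) ?modn_mod ?modzMml.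
have superE N (b z : int) : (0 < N)%N -> coprimez b N ->
    supercharacter R N b z = \sum_(0 <= i < ordmod N b) psi N b z i.
  move=> N0 bN; apply: sum_period_shift.
  by rewrite -!/(psi N b z _) -psi_mod // modnn.
rewrite /supercharacter ordL sum_residues; apply: eq_bigr => j _.
rewrite -!/(supercharacter _ _ _ _) !superE ?coprimezXl // ord_mu ord_nu.
rewrite -sum_crt //; first last.
- by move=> i; rewrite -ord_nu psi_mod // coprimezXl.
- by move=> i; rewrite -ord_mu psi_mod // coprimezXl.
- by rewrite -ord_mu.
apply: eq_bigr => q _.
(* Exponents j + u q come from raising the u-th power of omega to the q. *)
have split_mod (N : nat) (z : int) :
    ((omega %% N)%Z ^+ u ^+ q * (omega ^+ j * z) =
    omega ^+ (j + u * q) * z %[mod N])%Z.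
  by rewrite -exprM -modzMml modzXm modzMml mulrA -exprD addnC.
rewrite /psi (@eq_e_mod R _ _ _ m_gt0 (split_mod m t)).
rewrite (@eq_e_mod R _ _ _ n_gt0 (split_mod n s)).
rewrite -eD; congr e; rewrite !(intrM, intrD) natrM.
by field; rewrite !pnatr_eq0 -!lt0n m_gt0 n_gt0.
Qed.
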